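(* If $X$ is a smooth fan and its set of endpoints $E(X)$ is not dense in $X$, then the space $E(X)$ has a point of zero-dimensionality. In particular, $E(X)$ is not homeomorphic to complete Erdős space $\mathfrak{E}_c$.
   Context: A continuum is a compact connected metric space; it is non-degenerate if it has more than one point. The Cantor fan $F_C$ is the cone over the Cantor set $C$. A smooth fan is a non-degenerate continuum $X$ homeomorphic to a subcontinuum of $F_C$; it is always assumed that the embedding is such that the image contains the cone point and the cone point has order at least $2$ in $X$. Here a point $x$ has order at least $n$ in $X$ if there are $n$ arcs in $X$ having $x$ as one endpoint which are otherwise pairwise disjoint. An endpoint of $X$ is a point of order exactly $1$; $E(X)$ denotes the set of endpoints of $X$ with the subspace topology. A point of zero-dimensionality of a space $Y$ is a point of $Y$ that has a local base consisting of clopen subsets of $Y$. Complete Erdős space is the subspace $\mathfrak{E}_c = \{ \langle x_n \rangle_{n \in \omega} \in \ell^2 : \forall i \in \omega,\ x_i \in \{0\} \cup \{1/n : n \in \mathbb{N}\} \}$ (with $n\geq 1$) of the Hilbert space $\ell^2$ of square-summable real sequences. *)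

(* Defs.v *)
From HB Require Import structures.
From mathcomp Require Import all_boot all_order all_algebra generic_quotient finmap.
From mathcomp Require Import all_classical all_reals all_analysis.

Set Implicit Arguments.
Unset Strict Implicit.
Unset Printing Implicit Defensive.

Import Order.TTheory GRing.Theory Num.Theory.
Import numFieldNormedType.Exports.

Local Open Scope classical_set_scope.
Local Open Scope ring_scope.
Local Open Scope quotient_scope.

Definition is_homeomorphism (T U : topologicalType) (f : T -> U) :=
  continuous f /\
  exists g : U -> T, [/\ continuous g, cancel f g & cancel g f].

Definition homeomorphic (T U : topologicalType) :=
  exists f : T -> U, is_homeomorphism f.

(* A set used as a type carries the initial topology of its inclusion. *)
Definition unit_interval (R : realType) : topologicalType :=
  (`[0, 1]%classic : set R).

Section unit_interval.
Context {R : realType}.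

Let unit0_subproof : (0 : R) \in `[0, 1]%classic.
Proof. by rewrite inE/= in_itv/= lexx ler01. Qed.

Let unit1_subproof : (1 : R) \in `[0, 1]%classic.
Proof. by rewrite inE/= in_itv/= ler01 lexx. Qed.

Definition unit0 : unit_interval R := SigSub unit0_subproof.
Definition unit1 : unit_interval R := SigSub unit1_subproof.

End unit_interval.

(* The cone over T is T * [0, 1] with T * {0} collapsed to a point. *)
Section cone.
Context (R : realType) (T : ptopologicalType).

Let cone_rel' (a b : T * unit_interval R) :=
  (a == b) || ((a.2 == unit0) && (b.2 == unit0)).

Let cone_rel_refl : reflexive cone_rel'.
Proof. by move=> a; rewrite /cone_rel' eqxx. Qed.

Let cone_rel_sym : symmetric cone_rel'.
Proof. by move=> a b; rewrite /cone_rel' eq_sym andbC. Qed.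

Let cone_rel_trans : transitive cone_rel'.
Proof.
move=> a b c /predU1P[-> //|] + /predU1P[<- //|]; rewrite /cone_rel'.
by move=> /andP[-> _] /andP[_ ->]; rewrite orbT.
Qed.

Definition cone_rel := EquivRel _ cone_rel_refl cone_rel_sym cone_rel_trans.

Definition cone := {eq_quot cone_rel}.

HB.instance Definition _ := Topological.copy cone (quotient_topology cone).
HB.instance Definition _ := Quotient.on cone.

Definition cone_point : cone := \pi_cone (point, unit0).

End cone.
Arguments cone_point {R T}.

Definition cantor_fan (R : realType) : topologicalType := cone R cantor_space.

Section order.
Context (R : realType) (X : topologicalType).

Definition is_arc (A : set X) (a b : X) :=
  exists f : unit_interval R -> A,
    [/\ is_homeomorphism f, set_val (f unit0) = a & set_val (f unit1) = b].

(* Arcs are reversible, so requiring x to be the first endpoint loses nothing;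
   the arcs may meet only in x. *)
Definition order_at_least (n : nat) (x : X) :=
  exists A : 'I_n -> set X,
    (forall i, exists y, is_arc (A i) x y) /\
    trivIset [set: 'I_n] (fun i => A i `\ x).

Definition endpoints : set X :=
  [set x | order_at_least 1 x /\ ~ order_at_least 2 x].

End order.
Arguments endpoints R X : clear implicits.

Definition nondegenerate_continuum (R : realType) (X : metricType R) :=
  [/\ compact [set: X], connected [set: X] & exists x y : X, x != y].

(* The point v is the preimage of the vertex of the cone under the embedding. *)
Definition smooth_fan (R : realType) (X : metricType R) :=
  nondegenerate_continuum X /\
  exists (K : set (cantor_fan R)) (h : X -> K),
    [/\ compact K, connected K, is_homeomorphism h &
        exists2 v : X, set_val (h v) = cone_point & order_at_least R 2 v].

Definition zero_dimensional_at (Y : topologicalType) (y : Y) :=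
  exists B : set (set Y),
    [/\ B `<=` clopen, (forall U, B U -> U y) &
        forall V, nbhs y V -> exists2 U, B U & U `<=` V].

(* For the counting measure on nat, every sequence is measurable and the
   2-norm is (\sum_k |x k|^2)^(1/2). *)
Definition ell2 (R : realType) : Type :=
  LfunType (@counting nat R) (lee1n 2).

Section ell2.
Context (R : realType).

HB.instance Definition _ := GRing.Lmodule.on (ell2 R).

Definition ell2_norm (x : ell2 R) : R :=
  fine (Lnorm (@counting nat R) 2%:R%:E (EFin \o x)).

Let ell2_normD (x y : ell2 R) :
  ell2_norm (x + y) <= ell2_norm x + ell2_norm y.
Proof. exact: ler_LnormD. Qed.

Let ell2_normZ (l : R) (x : ell2 R) :
  ell2_norm (l *: x) = `|l| * ell2_norm x.
Proof.
apply: EFin_inj; rewrite EFinM /ell2_norm.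
rewrite (finite_norm_fine (l *: x : LfunType _ _)).
by rewrite (finite_norm_fine (x : LfunType _ _)) -LnormZ.
Qed.

Let ell2_norm0_eq0 (x : ell2 R) : ell2_norm x = 0 -> x = 0.
Proof.
move=> /fine_Lnormr_eq0 -[N [_ N0 xN]]; apply/LfuneqP => k.
apply: contrapT => xk; have Nk : N k by apply: xN => /(_ I)/xk.
move: N0; rewrite /= /counting; case: ifPn => // /asboolP finN [] /eqP.
rewrite pnatr_eq0 cardfs_eq0 => /eqP N0.
by move: Nk; rewrite -(fset_setK finN) N0.
Qed.

HB.instance Definition _ := @Lmodule_isNormed.Build R (ell2 R)
  ell2_norm ell2_normD ell2_normZ ell2_norm0_eq0.

End ell2.

Definition complete_erdos (R : realType) : set (ell2 R) :=
  [set x : ell2 R |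
    forall i : nat, x i = 0 \/ exists2 n : nat, (0 < n)%N & x i = n%:R^-1].
Arguments complete_erdos R : clear implicits.

(* Main.v *)
Require Import Defs.
From HB Require Import structures.
From mathcomp Require Import all_boot all_order all_algebra.
From mathcomp Require Import all_classical all_reals all_analysis.
From mathcomp Require Import lra ring.

(** Write a point of the Cantor fan as (leg, height). A subcontinuum containing
    the vertex meets each leg in an initial segment, so its endpoints are exactly
    the tops of these segments, and the height of the top is an upper
    semicontinuous function of the leg. If some open set [U x (a, b)], with [U]
    clopen, contains no endpoint, then for [s] in [(a, b)] the endpoints over [U]
    above height [s] form a clopen set of endpoints, and the legs carrying them
    form a compact set. As an upper semicontinuous function, the top height has a
    point of continuity there, found by nested clopen sets of shrinking
    oscillation. At such a point the clopen sets of legs give a clopen local base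
    of the space of endpoints. Complete Erdos space has no such point, because
    none of its nonempty clopen subsets is bounded. *)

Set Implicit Arguments.
Unset Strict Implicit.
Unset Printing Implicit Defensive.

Import Order.TTheory GRing.Theory Num.Theory.
Import numFieldNormedType.Exports.

Local Open Scope classical_set_scope.
Local Open Scope ring_scope.

(** * Arcs as compact connected sets, and arcs from height functions *)

Section arcs.
Context {R : realType} {X : topologicalType}.

Lemma arc_properties (A : set X) x y : is_arc R A x y ->
  [/\ compact A, connected A, A x, A y & x <> y].
Proof.
move=> [f [[cf [g [_ fK gK]]] fx fy]].
(* Extending the parametrization to all of [R] lets compactness and connectedness of the segment be
   used directly. *)
pose F : R -> X := valL_ x (set_val \o f).
have FE : forall u : unit_interval R, F (set_val u) = set_val (f u).
  by move=> u; have /(congr1 (@^~ u)) := valLK x (set_val \o f).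
have cF : {within `[0, 1], continuous F}.
  apply/(@subspace_valL_continuousP' R `[0, 1]) => u.
  by apply: continuous_comp; [exact: cf|exact: initial_continuous].
have FA : F @` `[0, 1] = A.
  apply/seteqP; split=> [_ [s s01 <-]|z Az].
    have -> : s = set_val (SigSub (mem_set s01) : unit_interval R) by [].
    by rewrite FE; exact: set_valP.
  pose u := g (SigSub (mem_set Az)).
  by exists (set_val u); [exact: set_valP|rewrite FE gK].
rewrite -FA; split.
- by apply: continuous_compact => //; exact: segment_compact.
- by apply: connected_continuous_connected => //; exact: segment_connected.
- by rewrite -fx -FE; exists (set_val (unit0 : unit_interval R)) => //; exact: set_valP.
- by rewrite -fy -FE; exists (set_val (unit1 : unit_interval R)) => //; exact: set_valP.
- rewrite -fx -fy => /val_inj /(can_inj fK) /(congr1 val) /eqP /=.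
  by rewrite eq_sym oner_eq0.
Qed.

(** A continuous bijection from a compact space onto a Hausdorff one is a homeomorphism; here [tau]
    is the inverse of the parametrization, so only the target [R] has to be Hausdorff. *)
Lemma arc_of_compact (A : set X) (tau : X -> R) x y : compact A ->
  continuous tau -> {in A &, injective tau} -> tau @` A = `[0, 1]%classic ->
  A x -> A y -> tau x = 0 -> tau y = 1 -> is_arc R A x y.
Proof.
move=> cA ctau inj_tau tauA Ax Ay taux tauy.
have tau01 (a : A) : tau (set_val a) \in `[0, 1]%classic.
  by rewrite inE -tauA; exists (set_val a) => //; exact: set_valP.
pose g (a : A) : unit_interval R := SigSub (tau01 a).
have /choice[f fE] (u : unit_interval R) : exists a : A, g a = u.
  have : (tau @` A) (set_val u) by rewrite tauA; exact: set_valP.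
  by move=> [z Az zu]; exists (SigSub (mem_set Az)); exact: val_inj.
have tauf u : tau (set_val (f u)) = set_val u by rewrite -[in RHS](fE u).
have injA (a b : A) : tau (set_val a) = tau (set_val b) -> a = b.
  by move=> ab; apply/val_inj/inj_tau => //; rewrite inE; exact: set_valP.
have gK : cancel g f by move=> a; apply: injA; rewrite tauf.
exists f; split; last 2 first.
- have /(congr1 set_val)/= <- : SigSub (mem_set Ax) = f unit0.
    by apply: injA; rewrite tauf.
  by [].
- have /(congr1 set_val)/= <- : SigSub (mem_set Ay) = f unit1.
    by apply: injA; rewrite tauf.
  by [].
split; last first.
  exists g; split => //.
  move=> a N [_ [[B oB <-] Ba BN]].
  have cts : {for a, continuous (tau \o (set_val : A -> X))}.
    by apply: continuous_comp; [exact: initial_continuous|exact: ctau].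
  exact: filterS (fun b Bb => BN (g b) Bb) (cts B (open_nbhs_nbhs (conj oB Ba))).
move=> u N [_ [[B oB <-] Bu BN]].
have cAB : closed (tau @` (A `\` B)).
  apply: compact_closed; first exact: Rhausdorff.
  apply: continuous_compact; first exact: continuous_subspaceT.
  rewrite setDE; apply: compact_closedI => //; exact: open_closedC.
have : nbhs u (set_val @^-1` (~` (tau @` (A `\` B)))).
  apply: initial_continuous; apply: open_nbhs_nbhs; split.
    exact: closed_openC.
  move=> [z [Az nBz] zu]; apply: nBz.
  have fu : f u = SigSub (mem_set Az) by apply: injA; rewrite tauf -zu.
  by move: Bu; rewrite fu.
apply: filterS => w wAB; apply: BN; apply: contrapT => nBw; apply: wAB.
by exists (set_val (f w)) => //; split => //; exact: set_valP.
Qed.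

End arcs.

(** * Fans in height and leg coordinates: tops and zero-dimensionality *)

Section fan.
Context {R : realType} {X L : topologicalType}.
(* Coordinates of a fan with vertex [v]: the height [t x] above the vertex and
   the leg [p x] containing [x]; the value [p v] is irrelevant, which is why [p]
   is only continuous away from height 0. *)
Context (t : X -> R) (p : X -> L) (v : X).
Context (compactX : compact [set: X]) (connectedX : connected [set: X]).
Context (hausdorffX : hausdorff_space X) (hausdorffL : hausdorff_space L).
Context (clopen_baseL : forall (c : L) U, nbhs c U ->
  exists2 V, clopen V /\ V c & V `<=` U).
Context (cont_t : continuous t).
Context (cont_p : forall x, 0 < t x -> {for x, continuous p}).
Context (t_ge0 : forall x, 0 <= t x) (t_eq0 : forall x, t x = 0 <-> x = v).
Context (fan_inj : forall x y, 0 < t x -> t x = t y -> p x = p y -> x = y).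

Lemma closed_t_ge r : closed [set x | r <= t x].
Proof. by apply: (@preimage_closed _ _ t [set y | r <= y]) => //; exact: closed_ge. Qed.

Lemma closed_t_eq r : closed [set x | t x = r].
Proof. by apply: (@preimage_closed _ _ t [set y | y = r]) => //; exact: closed_eq. Qed.

Lemma closed_compact (F : set X) : closed F -> compact F.
Proof. by move=> cF; apply: subclosed_compact cF compactX _. Qed.

Lemma nbhs_t_gt x r : r < t x -> nbhs x [set y | r < t y].
Proof.
move=> rx; apply: (cont_t (x := x) (t := [set y | r < y])).
by apply: open_nbhs_nbhs; split => //; exact: open_gt.
Qed.

Lemma nbhs_t_lt x r : t x < r -> nbhs x [set y | t y < r].
Proof.
move=> rx; apply: (cont_t (x := x) (t := [set y | y < r])).
by apply: open_nbhs_nbhs; split => //; exact: open_lt.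
Qed.

Lemma nbhs_p x V : 0 < t x -> open V -> V (p x) -> nbhs x [set y | V (p y)].
Proof.
by move=> x0 oV Vx; apply: (cont_p x0 (t := V)); exact: open_nbhs_nbhs.
Qed.

Lemma open_leg_gt V r : 0 <= r -> open V -> open [set x | V (p x) /\ r < t x].
Proof.
move=> r0 oV; rewrite openE => x [/= Vx rx].
by apply: filterI; [exact: nbhs_p (le_lt_trans r0 rx) _ _|exact: nbhs_t_gt].
Qed.

Lemma closed_leg_ge V r : 0 < r -> closed V ->
  closed [set x | V (p x) /\ r <= t x].
Proof.
move=> r0 cV; rewrite -openC openE => x /= /not_andP.
have [rx [Vx|//]|xr _] := leP r (t x).
  apply: filterS (nbhs_p (lt_le_trans r0 rx) (closed_openC cV) Vx).
  by move=> y /= Vy [].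
by apply: filterS (nbhs_t_lt xr) => y /= yr []; rewrite leNgt yr.
Qed.

Lemma leg_tube F r c W : closed F -> 0 < r -> (forall x, F x -> r <= t x) ->
  (forall x, F x -> p x <> c) -> nbhs c W ->
  exists V, [/\ clopen V, V c, V `<=` W & forall x, F x -> ~ V (p x)].
Proof.
move=> cF r0 Fr Fc Wc.
have cpF : closed (p @` F).
  apply: compact_closed => //; apply: continuous_compact (closed_compact cF).
  apply: continuous_in_subspaceT => x /set_mem Fx.
  exact/cont_p/(lt_le_trans r0)/Fr.
have : nbhs c (W `&` ~` (p @` F)).
  apply: filterI => //; apply: open_nbhs_nbhs; split; first exact: closed_openC.
  by move=> [x Fx xc]; exact: Fc Fx xc.
move=> /clopen_baseL[V [cV Vc] VF]; exists V; split => //.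
  by move=> y /VF[].
by move=> x Fx /VF[_]; apply; exists x.
Qed.

(** If [A] had no point at height [s] on the leg of [e], neither would it over a small clopen set of
    legs; the part of [A] above [s] there would be clopen in [A], containing [e] but not [y]. *)
Lemma leg_connected A e y s : closed A -> connected A -> A e -> A y ->
  0 < s -> s < t e -> (p y = p e -> t y < s) ->
  exists z, [/\ A z, p z = p e & t z = s].
Proof.
move=> cA conA Ae Ay s0 se ys; apply: contrapT => noz.
(* [W] keeps [y] out of the part to be split off: either [y] is on the leg of [e] and low, or its
   leg is removed. *)
have [W Wc Wy] : exists2 W, nbhs (p e) W & W (p y) -> t y < s.
  have [/ys ?|pye] := pselect (p y = p e).
    by exists setT => //; exact: filterT.
  exists (~` [set p y]); last by move=> /(_ erefl).
  apply: open_nbhs_nbhs; split; last by move=> pey; apply: pye; rewrite pey.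
  exact/closed_openC/accessible_closed_set1/hausdorff_accessible.
have [||x [Ax /= xs] pxe|V [[oV cV] Ve VW AV]] :=
    @leg_tube (A `&` [set x | t x = s]) s (p e) W _ s0 _ _ Wc.
- by apply: closedI => //; exact: closed_t_eq.
- by move=> x [_ /= ->].
- by apply: noz; exists x.
have AVE : A `&` [set x | V (p x) /\ s < t x] = A `&` [set x | V (p x) /\ s <= t x].
  apply/seteqP; split=> x [Ax [Vx sx]]; split => //; split => //.
    exact: ltW.
  by rewrite lt_neqAle sx andbT; apply/eqP => sx'; apply: (AV x).
have AV_A : A `&` [set x | V (p x) /\ s < t x] = A.
  apply: conA.
  - by exists e.
  - exists [set x | V (p x) /\ s < t x] => //.
    by apply: open_leg_gt => //; exact: ltW.
  - exists [set x | V (p x) /\ s <= t x]; last exact: AVE.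
    exact: closed_leg_ge.
have : (A `&` [set x | V (p x) /\ s < t x]) y by rewrite AV_A.
move=> [_ [/VW/Wy ys' sy]].
by have := lt_trans ys' sy; rewrite ltxx.
Qed.

(** Endpoints in terms of the coordinates; [top_endpoint] proves the agreement. *)
Definition top x := 0 < t x /\ forall y, p y = p x -> t y <= t x.

(** Including the vertex makes the leg closed, whatever the value [p v] is. *)
Definition leg c := [set x | t x = 0 \/ p x = c].

Lemma closed_leg c : closed (leg c).
Proof.
rewrite /leg -openC openE => x /= /not_orP[x0 xc].
have tx0 : 0 < t x by rewrite lt_def t_ge0 andbT; exact/eqP.
have : nbhs x [set y | (~` [set c]) (p y) /\ 0 < t y].
  apply: open_nbhs_nbhs; split => //; apply: open_leg_gt => //.
  exact/closed_openC/accessible_closed_set1/hausdorff_accessible.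
apply: filterS => y /= [yc y0] [ty0|//].
by rewrite ty0 ltxx in y0.
Qed.

Lemma leg_gap x s : 0 < s -> s <= t x -> exists z, p z = p x /\ t z = s.
Proof.
move=> s0; rewrite le_eqVlt => /predU1P[->|sx]; first by exists x.
have := @leg_connected setT x v s closedT connectedX I I s0 sx.
have /t_eq0-> : v = v by [].
by move=> /(_ (fun=> s0))[z [_ ? ?]]; exists z.
Qed.

Lemma top_exists x : 0 < t x -> exists e, [/\ top e, p e = p x & t x <= t e].
Proof.
move=> x0; have cleg := closed_compact (@closed_leg (p x)).
have [||e /set_mem /= elt emax] := compact_EVT_max _ cleg (f := t).
- by exists x; right.
- exact: continuous_subspaceT.
have xe : t x <= t e by apply: emax; rewrite inE; right.
have e0 := lt_le_trans x0 xe.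
have ex : p e = p x by case: elt => // e00; rewrite e00 ltxx in e0.
exists e; split => //; split => // y yx; apply: emax; rewrite inE/=; right.
by rewrite yx.
Qed.

(* The tops in [V] above height [s] whose heights are within [e] of the infimum
   can be isolated by a smaller clopen [V'], because the top height is an upper
   semicontinuous function of the leg. *)
Lemma shrink_oscillation (s e : R) V : 0 < s -> 0 < e -> clopen V ->
  (exists x, [/\ top x, V (p x) & s <= t x]) ->
  exists V', [/\ clopen V', V' `<=` V,
    (exists x, [/\ top x, V' (p x) & s <= t x]) &
    forall x y, V' (p x) -> V (p y) -> s <= t y -> top y -> t x < t y + e].
Proof.
move=> s0 e0 [oV cV] [x0 [topx0 Vx0 sx0]].
pose H := [set t x | x in [set x | [/\ top x, V (p x) & s <= t x]]].
have infH : has_inf H.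
  split; first by exists (t x0), x0.
  by exists 0 => _ [x _ <-].
have [_ [x [topx Vx sx] <-] xe] := inf_adherent e0 infH.
have ie0 : 0 < inf H + e by apply: le_lt_trans xe.
have [//|y yie yx||V' [cV' V'x V'V V'le]] :=
  @leg_tube [set y | inf H + e <= t y] _ (p x) V (@closed_t_ge _) ie0.
- have := lt_le_trans xe (le_trans yie (topx.2 _ yx)).
  by rewrite ltxx.
- exact: open_nbhs_nbhs.
exists V'; split => //; first by exists x.
move=> y z V'y Vz sz topz.
have [yie|/lt_le_trans] := leP (inf H + e) (t y); first by case: (V'le y).
apply; rewrite lerD2r; apply: ge_inf; first exact: infH.2.
by exists z.
Qed.

Lemma zero_dimensional_top W : open W -> W !=set0 -> W <> [set v] ->
  (forall x, W x -> ~ top x) ->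
  exists2 e, top e & forall N, nbhs e N -> exists O C,
    [/\ open O, closed C, O e, forall x, top x -> (O x <-> C x) &
      forall x, O x -> top x -> N x].
Proof.
move=> oW [w Ww] Wv Wtop.
have [x0 Wx0 x00] : exists2 x, W x & 0 < t x.
  apply: contrapT => noW; apply: Wv; have W_v x : W x -> x = v.
    move=> Wx; apply/t_eq0; apply: contrapT => /eqP x0; apply: noW.
    by exists x => //; rewrite lt_def x0 t_ge0.
  by apply/seteqP; split => [x /W_v //|_ ->]; rewrite -(W_v w).
pose s := t x0.
(* The only point at height [s] on the leg of [x0] is [x0] itself, which is in [W]. Over a small [U]
   all points at height [s] are therefore in [W], so no top over [U] has height exactly [s]. *)
have [||x [nWx /= xs] xx0|U [cU Ux0 _ UW]] :=
  @leg_tube (~` W `&` [set x | t x = s]) s (p x0) setT _ x00 _ _ filterT.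
- by apply: closedI; [exact: open_closedC|exact: closed_t_eq].
- by move=> x [_ /= ->].
- by apply: nWx; rewrite (fan_inj _ xs xx0)// xs.
have Utop x : U (p x) -> top x -> t x <> s.
  move=> Ux topx xs; have [Wx|nWx] := pselect (W x); first exact: Wtop Wx _.
  exact: (UW x).
pose good V := clopen V /\ exists x, [/\ top x, V (p x) & s <= t x].
have goodU : good U.
  split => //; have [e [tope ex0 xe]] := top_exists x00.
  by exists e; rewrite ex0.
have /choice[f fP] : forall nV : nat * set L, exists V', good nV.2 ->
  [/\ good V', V' `<=` nV.2 & forall x y, V' (p x) -> nV.2 (p y) ->
    s <= t y -> top y -> t x < t y + nV.1.+1%:R^-1].
  move=> [n V]; have [[cV exV]|ngood] := pselect (good V); last by exists V.
  have n0 : 0 < n.+1%:R^-1 :> R by rewrite invr_gt0.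
  have [V' [? ? ? ?]] := shrink_oscillation x00 n0 cV exV.
  by exists V'.
pose Vs := nat_rect (fun=> set L) U (fun n V => f (n, V)).
have goodVs n : good (Vs n).
  by elim: n => // n IH; case: (fP (n, Vs n) IH).
have VsS n : Vs n.+1 `<=` Vs n by case: (fP (n, Vs n) (goodVs n)).
have Vs_osc n x y : Vs n.+1 (p x) -> Vs n (p y) -> s <= t y -> top y ->
    t x < t y + n.+1%:R^-1.
  by case: (fP (n, Vs n) (goodVs n)) => _ _; apply.
have Vs_le m n : (m <= n)%N -> Vs n `<=` Vs m.
  by move=> /subnK <-; elim: (n - m)%N => [//|k IH]; apply: subset_trans IH; exact: VsS.
have /choice[u uP] n : exists x, [/\ top x, Vs n (p x) & s <= t x].
  by case: (goodVs n).
(* A cluster point of the chosen tops lies over every [Vs n] at height at least [s]; the top of its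
   leg is the required point. *)
have [z [_ uz]] := compactX (fmap_proper_filter u eventually_filter) filterT.
have zVs n : Vs n (p z) /\ s <= t z.
  apply: (closed_leg_ge x00 (goodVs n).1.2) => B Bz.
  apply: uz Bz; exists n => // k /= nk.
  by have [_ Vk sk] := uP k; split => //; exact: (Vs_le _ _ nk).
have sz : s <= t z by case: (zVs 0%N).
have [e [tope ez ze]] := top_exists (lt_le_trans x00 sz).
have se := le_trans sz ze.
have eVs n : Vs n (p e) by rewrite ez; case: (zVs n).
exists e => // N; rewrite nbhsE => -[{}N' [oN Ne] NN].
(* The part of the leg outside [N'] is compact and misses [e], so its greatest height, if it is
   nonempty, is below [t e]. *)
have [r [r0 re Nr]] : exists r, [/\ 0 < r, r < t e &
    forall y, ~ N' y -> p y = p e -> t y < r].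
  pose K := leg (p e) `&` ~` N'.
  have [K0|/set0P K0] := eqVneq K set0.
    exists (t e / 2); split; rewrite ?divr_gt0 ?tope.1//.
      by rewrite ltr_pdivrMr// ltr_pMr ?tope.1// ltr1n.
    move=> y nNy ye; exfalso; have : K y by split => //; right.
    by rewrite K0.
  have cK : compact K.
    by apply: closed_compact; apply: closedI; [exact: closed_leg|exact: open_closedC].
  have [|y /set_mem[ye nNy] ymax] := compact_EVT_max K0 cK (f := t).
    exact: continuous_subspaceT.
  have ylt : t y < t e.
    case: ye => [->|ye]; first exact: tope.1.
    rewrite lt_neqAle tope.2// andbT; apply/eqP => yte.
    by apply: nNy; rewrite (fan_inj _ yte ye)// yte tope.1.
  have [yr re] := midf_lt ylt.
  exists ((t y + t e) / 2); split => //; first exact: le_lt_trans yr.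
  move=> x nNx xe; apply: le_lt_trans yr; apply: ymax.
  by rewrite inE; split => //; right.
have [n nre] : exists n, n.+1%:R^-1 < t e - r.
  have := near_infty_natSinv_lt (PosNum (etrans (subr_gt0 _ _) re)).
  by move=> [n _ nP]; exists n; exact: (nP n (leqnn n)).
(* Over [V] every point of height at least [r] is in [N']. Since [e] lies over [Vs n.+1], the
   oscillation bound puts every top over [V] above [s] higher than [t e - n.+1%:R^-1], hence above
   [r]. *)
have [||x [nNx /= rx] xe||V [[oV cV] Ve VVs VN]] :=
  @leg_tube (~` N' `&` [set x | r <= t x]) r (p e) (Vs n) _ r0.
- by apply: closedI; [exact: open_closedC|exact: closed_t_ge].
- by move=> x [].
- by have := Nr x nNx xe; rewrite ltNge rx.
- by apply: open_nbhs_nbhs; split => //; exact: (goodVs n).1.1.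
have VU : V `<=` U by move=> c /VVs; exact: (Vs_le 0%N).
have stop x : top x -> V (p x) -> s <= t x -> s < t x.
  move=> topx Vx sx; rewrite lt_neqAle sx andbT; apply/eqP => xs.
  exact: (Utop x (VU _ Vx) topx).
exists [set x | V (p x) /\ s < t x], [set x | V (p x) /\ s <= t x]; split.
- exact: open_leg_gt (ltW x00) oV.
- exact: closed_leg_ge.
- by split => //; exact: stop.
- by move=> x topx; split=> -[Vx sx]; split => //; [exact: ltW|exact: stop].
- move=> x [Vx sx] topx; apply: NN; apply: contrapT => nNx.
  apply: (VN x) => //; split => //=.
  have := Vs_osc n e x (eVs _) (VVs _ Vx) (ltW sx) topx.
  by move: nre; set i := _^-1; clearbody i => *; lra.
Qed.

(** * Arcs inside legs, and the identification of tops with endpoints *)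

Lemma leg_inj c x y : leg c x -> leg c y -> t x = t y -> x = y.
Proof.
move=> lx ly xy; have [x0|x0] := eqVneq (t x) 0.
  by rewrite ((t_eq0 x).1 x0); apply/esym/t_eq0; rewrite -xy.
case: lx ly => [/eqP|lx]; first by rewrite (negbTE x0).
rewrite /leg/= -xy => -[/eqP|ly]; first by rewrite (negbTE x0).
by apply: fan_inj => //; [rewrite lt_def x0 t_ge0|rewrite lx ly].
Qed.

Lemma leg_surj c x r : leg c x -> 0 <= r -> r <= t x -> exists2 z, leg c z & t z = r.
Proof.
rewrite le_eqVlt => lx /predU1P[<- _|r0 rx]; first by exists v; [left|]; exact/t_eq0.
have [z [zx zr]] := leg_gap r0 rx; exists z => //; right.
by case: lx => [x0|<- //]; move: (lt_le_trans r0 rx); rewrite x0 ltxx.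
Qed.

(** Dividing by the signed difference covers both orders of the heights of [x] and [y], and the
    quotient parametrizes the arc from [x] to [y]. *)
Definition leg_arc c x y :=
  leg c `&` [set z | 0 <= (t z - t x) / (t y - t x) <= 1].

Lemma is_arc_leg_arc c x y : leg c x -> leg c y -> t x <> t y ->
  is_arc R (leg_arc c x y) x y.
Proof.
move=> lx ly /eqP xy; have yx0 : t y - t x != 0 by rewrite subr_eq0 eq_sym.
pose tau z := (t z - t x) / (t y - t x).
have ctau : continuous tau.
  move=> z; apply: cvgM; last exact: cvg_cst.
  by apply: cvgB; [exact: cont_t|exact: cvg_cst].
have carc : closed (leg_arc c x y).
  apply: closedI; first exact: closed_leg.
  apply: (@preimage_closed _ _ tau `[0, 1]%classic) => //.
  exact: interval_closed.
have taux : tau x = 0 by rewrite /tau subrr mul0r.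
have tauy : tau y = 1 by rewrite /tau divff.
apply: (arc_of_compact _ ctau) => //.
- exact: closed_compact.
- move=> z w /set_mem[lz _] /set_mem[lw _] /(mulIf _)-/(_ (invr_neq0 yx0)).
  by move=> /addIr /(leg_inj lz lw).
- apply/seteqP; split => [_ [z [_ z01] <-]|r r01]; first by rewrite /= in_itv.
  have /andP[r0 r1] : 0 <= r <= 1 by move: r01; rewrite /= in_itv.
  pose h := t x + r * (t y - t x).
  have h0 : 0 <= h.
    have -> : h = t x * (1 - r) + t y * r by rewrite /h; ring.
    by rewrite addr_ge0// mulr_ge0 ?t_ge0 ?subr_ge0.
  have [z lz zh] : exists2 z, leg c z & t z = h.
    have [txy|tyx] := leP (t x) (t y).
      apply: (leg_surj ly) => //; rewrite /h -lerBrDl ler_piMl//.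
      by rewrite subr_ge0.
    apply: (leg_surj lx) => //; rewrite /h gerDl mulr_ge0_le0//.
    by rewrite subr_le0 ltW.
  have tauz : tau z = r by rewrite /tau zh /h addrAC subrr add0r mulfK.
  by exists z => //; split => //=; rewrite -/(tau z) tauz r0.
- by split => //=; rewrite -/(tau x) taux lexx ler01.
- by split => //=; rewrite -/(tau y) tauy lexx ler01.
Qed.

(** By [leg_connected], an arc leaving a top has to run down its leg. Hence two arcs from a top
    overlap just below it. *)
Lemma arc_initial_segment e A y : top e -> is_arc R A e y ->
  exists2 r, r < t e & forall z, p z = p e -> r < t z -> t z < t e -> A z.
Proof.
move=> tope /arc_properties[cA conA Ae Ay ey].
(* The arc may stop at [y] on the leg itself; if [y] is on another leg, it covers every positive
   height below [e]. *)
have e0 := tope.1; pose r := if `[< p y = p e >] then t y else 0.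
have r0 : 0 <= r by rewrite /r; case: asboolP.
have yr : p y = p e -> t y <= r by rewrite /r; case: asboolP.
exists r => [|z ze rz zte].
  rewrite /r; case: asboolP => // ye; rewrite lt_neqAle tope.2// andbT.
  by apply/eqP => yte; apply: ey; rewrite (fan_inj _ (esym yte)).
have clA : closed A by exact: compact_closed.
have z0 := le_lt_trans r0 rz.
have [|w [Aw we wz]] := leg_connected clA conA Ae Ay z0 zte.
  by move=> /yr yr'; exact: le_lt_trans rz.
by rewrite (fan_inj _ (esym wz)) // ze we.
Qed.

(** Two arcs from a top share points below it. Conversely, a point of positive height that is not a
    top has one arc down to [v] and one up to a higher point of its leg, while [v] is no endpoint
    because of its order. *)
Lemma top_endpoint e : order_at_least R 2 v -> top e <-> endpoints R X e.
Proof.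
move=> v2; split=> [tope|[_ e2]].
  have e0 := tope.1; split.
    exists (fun=> leg_arc (p e) e v); split.
      move=> _; exists v; apply: is_arc_leg_arc; [by right| |].
        by left; exact/t_eq0.
      by have /t_eq0-> : v = v by []; move=> ee; rewrite ee ltxx in e0.
    by apply/trivIsetP => i j _ _ /eqP; rewrite !ord1.
  move=> [A [arcA /trivIsetP trivA]].
  have [y0 /(arc_initial_segment tope)[r0 r0e A0]] := arcA ord0.
  have [y1 /(arc_initial_segment tope)[r1 r1e A1]] := arcA ord_max.
  pose r := Num.max 0 (Num.max r0 r1).
  have re : r < t e by rewrite !gt_max e0 r0e.
  have [rs se] := midf_lt re; set s := (r + t e) / 2 in rs se.
  move: (rs); rewrite !gt_max => /and3P[s0 r0s r1s].
  have [z [ze zs]] := leg_gap s0 (ltW se).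
  have nze : z <> e by move=> ze'; rewrite -zs ze' ltxx in se.
  have : ((A ord0 `\ e) `&` (A ord_max `\ e)) z.
    by rewrite -zs in r0s r1s se; split; split => //; [exact: A0|exact: A1].
  by rewrite (trivA ord0 ord_max).
have e0 : 0 < t e.
  rewrite lt_def t_ge0 andbT; apply/eqP => /t_eq0 ev; apply: e2.
  by rewrite ev.
split => // y ye; rewrite leNgt; apply/negP => ey; apply: e2.
have le : leg (p e) e by right.
have ly : leg (p e) y by right.
have lv : leg (p e) v by left; exact/t_eq0.
have tv : t v = 0 by exact/t_eq0.
exists (fun i : 'I_2 => if i == ord0 then leg_arc (p e) e v else leg_arc (p e) e y).
split.
  move=> i; case: ifP => _; [exists v|exists y]; apply: is_arc_leg_arc => //.
    by rewrite tv => /eqP; rewrite gt_eqF.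
  by move=> /eqP; rewrite lt_eqF.
suff meet z : leg_arc (p e) e v z -> leg_arc (p e) e y z -> z = e.
  apply/trivIsetP => i j _ _ ij; apply/seteqP; split => // z [[]].
  case: ifPn => i0 iz nze [+ _]; case: ifPn => j0 jz.
  - by move: ij; rewrite (eqP i0) (eqP j0) eqxx.
  - exact/nze/meet.
  - exact/nze/meet.
  - by case: i j ij i0 j0 {iz jz} => [[|[|//]] ?] [[|[|//]] ?].
move=> [lz /= /andP[+ _]] [_ /= /andP[+ _]]; rewrite tv sub0r.
rewrite ler_ndivlMr ?oppr_lt0// mul0r ler_pdivlMr ?subr_gt0// mul0r.
rewrite subr_le0 subr_ge0 => ze ez.
by apply: (leg_inj lz le); apply/eqP; rewrite eq_le ze.
Qed.

End fan.

(** * Height and base coordinates on the cone *)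

Section cone_coordinates.
Context (R : realType) (T : ptopologicalType).
Local Open Scope quotient_scope.
Implicit Types (z : cone R T) (a : T * unit_interval R).

Definition cone_height z : R := set_val (repr z).2.
(** At the vertex the value depends on the chosen representative, so continuity is claimed at
    positive height only. *)
Definition cone_base z : T := (repr z).1.

Lemma repr_pi_cone a : repr (\pi_(cone R T) a) = a \/
  (repr (\pi_(cone R T) a)).2 = unit0 /\ a.2 = unit0.
Proof.
have /eqmodP/= : \pi_(cone R T) (repr (\pi_(cone R T) a)) = \pi_(cone R T) a.
  exact: reprK.
by move=> /predU1P[->|/andP[/eqP -> /eqP ->]]; [left|right].
Qed.

Lemma cone_height_pi a : cone_height (\pi_(cone R T) a) = set_val a.2.
Proof.
by rewrite /cone_height; have [->|[-> ->]] := repr_pi_cone a.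
Qed.

Lemma continuous_cone_height : continuous cone_height.
Proof.
apply/quotient_continuous.
have -> : cone_height \o \pi_(cone R T) = set_val \o snd.
  by apply/funext => a /=; rewrite cone_height_pi.
move=> a; apply: (@continuous_comp _ _ _ snd set_val); first exact: cvg_snd.
exact: initial_continuous.
Qed.

Lemma cone_height_ge0 z : 0 <= cone_height z.
Proof. by have := set_valP (repr z).2; rewrite /= in_itv/= => /andP[]. Qed.

Lemma cone_height_eq0 z : cone_height z = 0 <-> z = cone_point.
Proof.
split=> [z0|->]; last by rewrite cone_height_pi.
rewrite -[z]reprK; apply/eqmodP => /=; apply/orP; right; apply/andP; split => //.
exact/eqP/val_inj.
Qed.

Lemma cone_base_pi a : a.2 != unit0 -> cone_base (\pi_(cone R T) a) = a.1.
Proof.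
by rewrite /cone_base; have [->|[_ ->]] := repr_pi_cone a; rewrite ?eqxx.
Qed.

Lemma continuous_cone_base z : 0 < cone_height z -> {for z, continuous cone_base}.
Proof.
move=> z0 U; rewrite /= nbhsE => -[V [oV Vz] VU].
(* Above height 0 no points are identified, so the preimage of this set in the product is an open
   rectangle. *)
have : nbhs z [set w | V (cone_base w) /\ 0 < cone_height w].
  apply: open_nbhs_nbhs; split => //.
  rewrite /open/= /quotient_open.
  have -> : \pi_(cone R T) @^-1` [set w | V (cone_base w) /\ 0 < cone_height w] =
     (fst @^-1` V) `&` ((set_val \o snd) @^-1` [set r | 0 < r]).
    have neq0 a : 0 < set_val a.2 :> R -> a.2 != unit0.
      by apply: contraTneq => ->; rewrite ltxx.
    apply/seteqP; split => a [/=]; rewrite cone_height_pi => + a0.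
      by rewrite cone_base_pi ?neq0.
    by split; rewrite ?cone_base_pi ?neq0.
  apply: openI; first by apply: open_comp oV => a _; exact: cvg_fst.
  apply: (@open_comp _ _ _ [set r : R | 0 < r]); last exact: open_gt.
  move=> a _; apply: (@continuous_comp _ _ _ snd set_val); first exact: cvg_snd.
  exact: initial_continuous.
by apply: filterS => w [/VU].
Qed.

Lemma cone_coordinates_inj z w : cone_height z = cone_height w ->
  cone_base z = cone_base w -> z = w.
Proof.
move=> /val_inj zw2 zw1; rewrite -[z]reprK -[w]reprK.
by rewrite (surjective_pairing (repr z)) zw2 [(repr z).1]zw1 -surjective_pairing.
Qed.

End cone_coordinates.

(** * A point of zero-dimensionality among the endpoints of a smooth fan *)

Lemma endpoints_zero_dimensional (R : realType) (X : metricType R) :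
  smooth_fan X -> ~ dense (endpoints R X) ->
  exists e : endpoints R X, zero_dimensional_at e.
Proof.
move=> [[cX conX [x1 [x2 x12]]] [K [h [_ _ [ch [g [_ hK _]]] [v hv v2]]]]] ndense.
have hX : hausdorff_space X by exact: metric_hausdorff.
have hC := cantor_space_hausdorff.
pose z x : cone R cantor_space := set_val (h x).
have cz : continuous z.
  by move=> x; apply: continuous_comp; [exact: ch|exact: initial_continuous].
pose t x := cone_height (z x); pose p x := cone_base (z x).
have clopen_base (c : cantor_space) U : nbhs c U ->
    exists2 V, clopen V /\ V c & V `<=` U.
  move=> Uc; have [V [Vc cV] VU] := zero_dimensional_cvg (x := c) hC
    cantor_zero_dimensional cantor_space_compact Uc.
  by exists V.
have ct : continuous t.
  by move=> x; exact: (continuous_comp (cz x) (@continuous_cone_height _ _ (z x))).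
have cp x : 0 < t x -> {for x, continuous p}.
  by move=> x0; exact: (continuous_comp (cz x) (continuous_cone_base x0)).
have t0 x : 0 <= t x by exact: cone_height_ge0.
have zinj : injective z by move=> x y /val_inj/(can_inj hK).
have teq0 x : t x = 0 <-> x = v.
  rewrite cone_height_eq0; split=> [zx|->]; last exact: hv.
  by apply: zinj; rewrite zx -hv.
have tinj x y : 0 < t x -> t x = t y -> p x = p y -> x = y.
  by move=> _ txy pxy; apply/zinj/cone_coordinates_inj.
have topE x := top_endpoint cX conX hX hC clopen_base ct cp t0 teq0 tinj x v2.
have [W [oW W0 WE]] : exists W, [/\ open W, W !=set0 &
    forall x, W x -> ~ top t p x].
  move: ndense; rewrite /dense => /existsNP[W /not_implyP[W0 /not_implyP[oW WE]]].
  exists W; split => // x Wx /topE Ex; apply: WE.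
  by exists x.
(* Otherwise [[set v]] would be clopen in the connected space [X], which has two points. *)
have Wv : W <> [set v].
  move=> WvE; have WT : W = setT.
    apply: conX => //; first by exists W; rewrite ?setTI.
    exists W; rewrite ?setTI// WvE.
    exact/accessible_closed_set1/hausdorff_accessible.
  have [x1v x2v] : [set v] x1 /\ [set v] x2 by rewrite -WvE WT.
  by move: x12; rewrite x1v x2v eqxx.
have [e tope eN] := zero_dimensional_top cX hC clopen_base ct cp t0 teq0
  tinj oW W0 Wv WE.
pose e' : endpoints R X := SigSub (mem_set ((topE e).1 tope)).
exists e', [set O | clopen O /\ O e']; split.
- by move=> O [].
- by move=> O [].
move=> N [_ [[B oB <-] Be BN]].
have [P [Q [oP cQ Pe PQ PB]]] := eN B (open_nbhs_nbhs (conj oB Be)).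
exists (set_val @^-1` P); last first.
  by move=> x Px; apply/BN/PB => //; apply/topE; exact: set_valP.
split => //; split; first by exists P.
have -> : set_val @^-1` P = set_val @^-1` Q :> set (endpoints R X).
  by apply/seteqP; split => x /=; apply PQ; apply/topE; exact: set_valP.
by apply: preimage_closed => // x _; exact: initial_continuous.
Qed.

(** * The norm of [ell2] through partial sums of squares *)

Section ell2_coordinates.
Context (R : realType).
Implicit Types (x y : ell2 R) (u : nat -> R).

Lemma Lnorm_counting_sqr u :
  (Lnorm (@counting nat R) 2%:E (EFin \o u) `^ 2 =
   \sum_(k <oo) (u k ^+ 2)%:E)%E.
Proof.
rewrite poweR_Lnorm// ge0_integral_count; last by move=> k; exact: poweR_ge0.
apply: eq_eseriesr => k _ /=.
by rewrite powR_mulrn// -normrX ger0_norm// sqr_ge0.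
Qed.

Lemma ell2_norm_sqr x : (`|x| ^+ 2)%:E = (\sum_(k <oo) (x k ^+ 2)%:E)%E.
Proof.
rewrite -Lnorm_counting_sqr -powR_mulrn//.
rewrite (_ : `|x| = fine (Lnorm (@counting nat R) 2%:E (EFin \o x)))//.
by rewrite -poweR_EFin (finite_norm_fine (x : LfunType _ _)).
Qed.

Lemma le_sum_ell2_norm_sqr x n : \sum_(0 <= k < n) x k ^+ 2 <= `|x| ^+ 2.
Proof.
rewrite -lee_fin ell2_norm_sqr -sumEFin.
by apply: nneseries_lim_ge => k _ _; rewrite lee_fin sqr_ge0.
Qed.

Lemma sum_sqr_lim_le u (M : R) : (forall n, \sum_(0 <= k < n) u k ^+ 2 <= M) ->
  (\sum_(k <oo) (u k ^+ 2)%:E <= M%:E)%E.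
Proof.
move=> uM; apply: lime_le.
  by apply: is_cvg_nneseries => k _ _; rewrite lee_fin sqr_ge0.
by apply: nearW => n; rewrite sumEFin lee_fin.
Qed.

Lemma ell2_norm_sqr_le x (M : R) :
  (forall n, \sum_(0 <= k < n) x k ^+ 2 <= M) -> `|x| ^+ 2 <= M.
Proof. by move=> /sum_sqr_lim_le; rewrite -ell2_norm_sqr lee_fin. Qed.

Lemma ell2_of_bounded_sums u (M : R) :
  (forall n, \sum_(0 <= k < n) u k ^+ 2 <= M) -> exists x, x =1 u.
Proof.
move=> /sum_sqr_lim_le uM.
have uL : u \in Lfun (@counting nat R) 2%:E.
  apply/andP; split; rewrite inE/=; first by [].
  rewrite /finite_norm ltNge leye_eq; apply/negP => /eqP uoo.
  by move: uM; rewrite -Lnorm_counting_sqr uoo poweRyr.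
by exists (Lfun_Sub (lee1n 2) uL).
Qed.

End ell2_coordinates.

Lemma small_tail (R : realType) (u : nat -> R) (M e : R) :
  (forall k, 0 <= u k) -> (forall n, \sum_(0 <= k < n) u k <= M) -> 0 < e ->
  exists N, forall i n, (N <= i)%N -> \sum_(i <= k < n) u k < e.
Proof.
move=> u0 uM e0; pose H := range (fun n => \sum_(0 <= k < n) u k).
have supH : has_sup H.
  by split; [exists (\sum_(0 <= k < 0) u k), 0|exists M => _ [n _ <-]].
(* The partial sum up to [N] is within [e] of the supremum, so later blocks of nonnegative terms add
   less than [e]. *)
have [_ [N _ <-] NH] := sup_adherent e0 supH.
exists N => i n Ni; have [ni|/ltnW ni] := leqP n i; first by rewrite big_geq.
have : \sum_(0 <= k < n) u k <= sup H by apply: sup_upper_bound => //; exists n.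
rewrite (big_cat_nat (leq0n N) (leq_trans Ni ni))/=.
rewrite [X in _ + X](big_cat_nat Ni ni)/=.
have : 0 <= \sum_(N <= k < i) u k by exact: sumr_ge0.
by move: NH; lra.
Qed.
Lemma sqrB_le (R : realDomainType) (a b : R) :
  (a - b) ^+ 2 <= 2 * (a ^+ 2 + b ^+ 2).
Proof. by have := sqr_ge0 (a + b); rewrite !expr2; lra. Qed.

(** * Complete Erdos space is nowhere zero-dimensional *)

Section complete_erdos_not_zero_dimensional.
Context (R : realType).
Local Notation E := (complete_erdos R).

(** Stated for arbitrary sequences, so that it applies before square-summability is known. *)
Definition erdos_coordinates (u : nat -> R) :=
  forall i : nat, u i = 0 \/ exists2 n : nat, (0 < n)%N & u i = n%:R^-1.

Lemma erdos_of_coordinates u (M : R) : erdos_coordinates u ->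
  (forall n, \sum_(0 <= k < n) u k ^+ 2 <= M) ->
  exists b : E, set_val b =1 u.
Proof.
move=> uE /ell2_of_bounded_sums[x xu].
have Ex : complete_erdos R x by move=> i; rewrite xu; exact: uE.
by exists (SigSub (mem_set Ex)).
Qed.

Lemma erdos_open_ball (P : set E) b : open P -> P b ->
  exists2 e : R, 0 < e & forall b', `|set_val b' - set_val b| < e -> P b'.
Proof.
move=> [Q oQ <-] Qb.
have /nbhs_ballP[e /= e0 eQ] : nbhs (set_val b) Q by exact: open_nbhs_nbhs.
exists e => // b' b'b; apply: eQ.
by rewrite -ball_normE /ball_/= distrC.
Qed.

(* Erdos' argument: run through the coordinates [i = 0, 1, ...] of a point of
   the bounded clopen set [B] and replace the [i]-th one by [1/(m+1)], where [m]
   counts the previous rejections, unless this leaves [B]. Since [B] is bounded,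
   infinitely many replacements are rejected, so the limit of the process is in
   [B] but at distance 0 from its complement. *)
Lemma complete_erdos_not_zero_dimensional (e : E) : ~ zero_dimensional_at e.
Proof.
move=> [BB [BBclopen BBe BBbase]].
have [B [oB cB] [Be Bball]] : exists2 B : set E, clopen B &
    B e /\ forall b, B b -> `|set_val b - set_val e| < 1.
  have [|B BBB BV] := BBbase [set b : E | `|set_val b - set_val e| < 1].
    exists (set_val @^-1` (ball (set_val e) 1)); split.
    - by exists (ball (set_val e) 1) => //; exact: ball_open.
    - by apply: ballxx.
    - by move=> b; rewrite /preimage /= -ball_normE /ball_/= distrC.
  by exists B; [exact: BBclopen|split; [exact: BBe|exact: BV]].
pose x0 : nat -> R := set_val e.
have x0E : erdos_coordinates x0 by exact: (set_valP e).
pose good (w : nat -> R) := exists2 b, B b & set_val b =1 w.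
pose upd i (s : (nat -> R) * nat) : nat -> R :=
  fun k => if k == i then s.2.+1%:R^-1 else s.1 k.
(* The state is the current sequence together with the number of rejections so far. *)
pose step i (s : (nat -> R) * nat) :=
  if `[< good (upd i s) >] then (upd i s, s.2) else (s.1, s.2.+1).
pose S := nat_rect (fun=> ((nat -> R) * nat)%type) (x0, 0%N) step.
pose w i := (S i).1; pose m i := (S i).2.
have SS i : S i.+1 = step i (S i) by [].
have w_good i : good (w i).
  rewrite /w; elim: i => [|i IH]; first by exists e.
  by rewrite SS /step; case: asboolP.
have wS i k : k != i -> w i.+1 k = w i k.
  by move=> /negbTE ki; rewrite /w SS /step; case: asboolP => //= _; rewrite /upd ki.
have w_x0 i k : (i <= k)%N -> w i k = x0 k.
  elim: i => // i IH ik; rewrite wS ?gtn_eqF//; apply: IH; exact: ltnW.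
(* Coordinate [k] changes at step [k] only, so this is the coordinatewise limit. *)
pose y k := w k.+1 k.
have w_y i k : (k < i)%N -> w i k = y k.
  elim: i => // i IH; rewrite ltnS leq_eqVlt => /predU1P[->//|ki].
  by rewrite wS ?ltn_eqF// IH.
have wE i : erdos_coordinates (w i).
  by have [b _ bw] := w_good i; move=> k; rewrite -bw; exact: (set_valP b).
pose M : R := (`|set_val e : ell2 R| + 1) ^+ 2.
have BM b n : B b -> \sum_(0 <= k < n) (set_val b) k ^+ 2 <= M.
  move=> /Bball be; apply: le_trans (le_sum_ell2_norm_sqr _ _) _.
  rewrite ler_sqr ?nnegrE ?addr_ge0//.
  rewrite -[X in `|X|](subrK (set_val e)) addrC.
  by apply: le_trans (ler_normD _ _) _; rewrite lerD2l ltW.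
have wM i n : \sum_(0 <= k < n) w i k ^+ 2 <= M.
  have [b Bb bw] := w_good i.
  have -> : w i = set_val b :> (nat -> R) by apply/funext => k; rewrite bw.
  exact: BM.
have yM n : \sum_(0 <= k < n) y k ^+ 2 <= M.
  rewrite (eq_big_nat _ _ (F2 := fun k => w n k ^+ 2)) => // k /andP[_ kn].
  by rewrite w_y.
have yE : erdos_coordinates y by move=> k; exact: wE.
have x0M n : \sum_(0 <= k < n) x0 k ^+ 2 <= M by exact: (wM 0%N).
have [b by_] := erdos_of_coordinates yE yM.
have mS i : m i.+1 = if `[< good (upd i (S i)) >] then m i else (m i).+1.
  by rewrite /m SS /step; case: asboolP.
have m_mono i j : (i <= j)%N -> (m i <= m j)%N.
  move=> /subnK <-; elim: (j - i)%N => // k IH; apply: leq_trans IH _.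
  by rewrite addSn mS; case: asboolP.
(* Without rejections from [N] on, all later coordinates of [y] would be the same positive number,
   against the bound [M] on its sums of squares. *)
have rejected N : exists2 i, (N <= i)%N & ~ good (upd i (S i)).
  apply: contrapT => norej.
  have acc i : (N <= i)%N -> good (upd i (S i)).
    by move=> Ni; apply: contrapT => ngood; apply: norej; exists i.
  have mN n : m (N + n)%N = m N.
    elim: n => [|n IH]; first by rewrite addn0.
    by rewrite addnS mS IH; case: asboolP => // /(_ (acc _ (leq_addr _ _))).
  have yN n : y (N + n)%N = (m N).+1%:R^-1.
    rewrite /y /w SS /step; case: asboolP => [_|/(_ (acc _ (leq_addr _ _)))//].
    by rewrite /upd /= eqxx -/(m (N + n)%N) mN.
  pose c : R := (m N).+1%:R^-1 ^+ 2.
  have c0 : 0 < c by rewrite exprn_gt0// invr_gt0.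
  have cM n : n%:R * c <= M.
    apply: le_trans (yM (N + n)%N).
    rewrite (big_cat_nat (leq0n N) (leq_addr n N))/= -[leLHS]add0r.
    apply: lerD; first by apply: sumr_ge0 => k _; exact: sqr_ge0.
    rewrite -{1}[N]add0n big_addn addKn (eq_bigr (fun=> c)).
      by rewrite sumr_const_nat subn0 mulr_natl.
    by move=> k _; rewrite addnC yN.
  have := cM (Num.trunc (M / c)).+1; rewrite leNgt => /negP; apply.
  rewrite -ltr_pdivrMr//; exact: truncnS_gt.
have m_unbounded N : exists j, (N <= m j)%N.
  elim: N => [|N [j Nj]]; first by exists 0%N.
  have [i ji rej] := rejected j; exists i.+1; rewrite mS.
  by case: asboolP => // _; rewrite ltnS (leq_trans Nj)// m_mono.
have reject N : exists i, [/\ (N <= i)%N, (N <= m i)%N, ~ good (upd i (S i)) &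
    y i = x0 i].
  have [j Nj] := m_unbounded N; have [i ji rej] := rejected (maxn j N).
  move: ji; rewrite geq_max => /andP[ji Ni].
  exists i; split => //; first by rewrite (leq_trans Nj)// m_mono.
  rewrite /y -(w_x0 i i)// /w SS /step; by case: asboolP.
(* One series controls both the tail of [x0 - y] and the single coordinates of [x0]; the constant in
   its bound comes from [sqrB_le]. *)
have tail (d : R) : 0 < d -> exists N, forall i n, (N <= i)%N ->
    \sum_(i <= k < n) ((x0 k - y k) ^+ 2 + x0 k ^+ 2) < d.
  apply: (@small_tail _ _ (2 * (M + M) + M)).
    by move=> k; rewrite addr_ge0// sqr_ge0.
  move=> n; apply: (@le_trans _ _
      (\sum_(0 <= k < n) (2 * (x0 k ^+ 2 + y k ^+ 2) + x0 k ^+ 2))).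
    by apply: ler_sum => k _; rewrite lerD2r sqrB_le.
  by rewrite big_split/= -mulr_sumr big_split/= lerD// ler_pM2l// lerD.
(* If [a] follows [y] before [i] and [x0] after [i], its squared distance to [b] splits into the
   term at [i] and a tail. *)
have near_b (a : E) i (c d : R) : (forall k, (k < i)%N -> set_val a k = y k) ->
    (forall k, (i < k)%N -> set_val a k = x0 k) ->
    (set_val a i - y i) ^+ 2 <= c ->
    (forall n, \sum_(i <= k < n) ((x0 k - y k) ^+ 2 + x0 k ^+ 2) < d) ->
    `|set_val a - set_val b : ell2 R| ^+ 2 <= c + d.
  move=> ay ax0 aic taild; apply: ell2_norm_sqr_le => n.
  rewrite (eq_bigr (fun k => (set_val a k - y k) ^+ 2)); last first.
    by move=> k _; rewrite -by_.
  have c0 := le_trans (sqr_ge0 _) aic.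
  have d0 : 0 <= d by have := taild 0%N; rewrite big_geq// => /ltW.
  have [ni|ni] := leqP n i.
    rewrite big_nat big1 ?addr_ge0// => k /andP[_ kn].
    by rewrite ay ?subrr ?expr0n// (leq_trans kn).
  have head0 : \sum_(0 <= k < i) (set_val a k - y k) ^+ 2 = 0.
    by rewrite big_nat big1// => k /andP[_ ki]; rewrite ay ?subrr ?expr0n.
  rewrite (big_cat_nat (leq0n i) (ltnW ni))/= head0 add0r.
  rewrite big_ltn// lerD//.
  apply: le_trans (ltW (taild n)); rewrite [leRHS]big_ltn// -[leLHS]add0r.
  apply: lerD; first by rewrite addr_ge0// sqr_ge0.
  rewrite big_nat [leRHS]big_nat; apply: ler_sum => k /andP[ik _].
  by rewrite ax0// lerDl sqr_ge0.
have tail1 i (d : R) : (forall n, \sum_(i <= k < n) ((x0 k - y k) ^+ 2 + x0 k ^+ 2) < d) ->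
    (x0 i - y i) ^+ 2 < d /\ x0 i ^+ 2 < d.
  move=> /(_ i.+1); rewrite big_nat1 => lt_d.
  by split; apply: le_lt_trans lt_d; rewrite ?lerDl ?lerDr sqr_ge0.
(* A late stage of the process is in [B]; the term at [N] and the tail contribute at most a third of
   [d ^+ 2] each. *)
have inB (d : R) : 0 < d -> exists2 a, B a & `|set_val a - set_val b : ell2 R| < d.
  move=> d0; have d1 : 0 < d ^+ 2 / 3 by rewrite divr_gt0// exprn_gt0.
  have [N tailN] := tail _ d1; have [a Ba aw] := w_good N; exists a => //.
  rewrite -ltr_sqr ?nnegrE ?normr_ge0 ?(ltW d0)//.
  have tN n := tailN N n (leqnn N); have [xyN _] := tail1 _ _ tN.
  apply: le_lt_trans (near_b a N (d ^+ 2 / 3) _ _ _ _ tN) _.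
  - by move=> k kN; rewrite aw w_y.
  - by move=> k Nk; rewrite aw w_x0// ltnW.
  - by rewrite aw w_x0//; exact: ltW xyN.
  - by move: (d ^+ 2) d1; clear => *; lra.
(* A late rejected update is outside [B]. At [i] it differs from [y] by [q - x0 i], whose square is
   at most [2 * (q ^+ 2 + x0 i ^+ 2)], that is four sixths of [d ^+ 2]; the tail adds one sixth. *)
have outB (d : R) : 0 < d -> exists2 a, ~ B a & `|set_val a - set_val b : ell2 R| < d.
  move=> d0; have d1 : 0 < d ^+ 2 / 6 by rewrite divr_gt0// exprn_gt0.
  have [N1 tailN] := tail _ d1.
  have [N2 _ invN2] := near_infty_natSinv_lt (PosNum d1).
  have [i [+ + nGi yi]] := reject (maxn N1 N2).
  rewrite !geq_max => /andP[N1i _] /andP[_ N2i].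
  have tN n := tailN i n N1i; have [_ x0i] := tail1 _ _ tN.
  have updE : erdos_coordinates (upd i (S i)).
    by move=> k; rewrite /upd; case: ifP => _; [right; exists (m i).+1|exact: wE].
  pose q : R := (m i).+1%:R^-1.
  have q0 : 0 <= q by rewrite invr_ge0.
  have updM n : \sum_(0 <= k < n) upd i (S i) k ^+ 2 <= M + q ^+ 2.
    apply: (@le_trans _ _
        (\sum_(0 <= k < n) (w i k ^+ 2 + if k == i then q ^+ 2 else 0))).
      apply: ler_sum => k _; rewrite /upd; case: ifP => _.
        by rewrite lerDr sqr_ge0.
      by rewrite addr0.
    rewrite big_split/= lerD// -big_mkcond/= big_nat1_eq.
    by case: ifP => _ //; exact: sqr_ge0.
  have [a aupd] := erdos_of_coordinates updE updM.
  exists a; first by move=> Ba; apply: nGi; exists a.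
  rewrite -ltr_sqr ?nnegrE ?normr_ge0 ?(ltW d0)//.
  have qd : q < d ^+ 2 / 6 by exact: invN2.
  have q1 : q ^+ 2 <= q.
    by rewrite expr2 ler_piMr// invf_le1 ?ler1n.
  apply: le_lt_trans (near_b a i (4 * (d ^+ 2 / 6)) _ _ _ _ tN) _.
  - by move=> k ki; rewrite aupd /upd ltn_eqF// -/(w i) w_y.
  - by move=> k ik; rewrite aupd /upd gtn_eqF// -/(w i) w_x0// ltnW.
  - rewrite aupd /upd eqxx yi -/(m i) -/q.
    apply: le_trans (sqrB_le _ _) _.
    by move: (x0 i ^+ 2) (q ^+ 2) (q) (d ^+ 2) x0i q1 qd; clear => *; lra.
  - by move: (d ^+ 2) (d1 : 0 < _); clear => *; lra.
(* [b] is a limit of points of [B] and of points outside [B], which is impossible for a clopen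
   set. *)
have [Bb|nBb] := pselect (B b).
  have [d d0 dB] := erdos_open_ball oB Bb.
  by have [a nBa /dB] := outB d d0.
have [d d0 dB] := erdos_open_ball (closed_openC cB) nBb.
by have [a Ba /dB] := inB d d0.
Qed.

End complete_erdos_not_zero_dimensional.

(** * Invariance under homeomorphism and conclusion *)

Lemma homeomorphic_zero_dimensional (T U : topologicalType) :
  homeomorphic T U -> (exists x : T, zero_dimensional_at x) ->
  exists y : U, zero_dimensional_at y.
Proof.
move=> [f [cf [g [cg fK gK]]]] [x [B [Bclopen Bx Bbase]]].
exists (f x), [set g @^-1` V | V in B]; split.
- by move=> _ [V BV <-]; apply: preimage_clopen cg; exact: Bclopen.
- by move=> _ [V BV <-]; rewrite /preimage /= fK; exact: Bx.
- move=> N /cf /Bbase[V BV VN]; exists (g @^-1` V); first by exists V.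
  by move=> y /VN; rewrite /preimage /= gK.
Qed.

Theorem theorem19 (R : realType) (X : metricType R) :
  smooth_fan X -> ~ dense (endpoints R X) ->
  (exists e : endpoints R X, zero_dimensional_at e) /\
  ~ homeomorphic (endpoints R X) (complete_erdos R).
Proof.
move=> fanX ndense; have zd := endpoints_zero_dimensional fanX ndense.
split=> // /homeomorphic_zero_dimensional/(_ zd)[b].
exact: complete_erdos_not_zero_dimensional.
Qed.
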